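(* Let $G$ be a simple loony endgame with at least one loop and with no 3-chains. Then opening a loop of smallest length in $G$ is an optimal move, i.e. $v(G;L)=v(G)$ where $L$ is a shortest loop of $G$.
   Context: Game. A dots and boxes game (position) $G$ consists of a finite set of unclaimed boxes and a finite set of undrawn lines, each undrawn line bordering either exactly one box or exactly two distinct boxes, each box being bordered by at least one and at most four undrawn lines. Two players play. The player to move draws (removes) an undrawn line; every box none of whose bordering lines is still undrawn is then claimed by that player. If the move claims at least one box the same player must move again (if a line remains); otherwise the other player moves. Claiming a box when possible is not compulsory. The game ends when no line remains. Each player maximises (own boxes) minus (opponent's boxes), counting only boxes claimed from $G$ onwards. Value. $v(G)$ is the net score, under optimal play, of the player who is NOT to move in $G$. Equivalently, $v(G)=0$ if $G$ has no undrawn lines, and otherwise $v(G)=\min_m v(G;m)$ over undrawn lines $m$, where, if drawing $m$ claims $k$ boxes and leaves the position $G_m$, then $v(G;m)=v(G_m)-k$ if $k\ge1$ and $v(G;m)=-v(G_m)$ if $k=0$. A move $m$ is optimal if $v(G;m)=v(G)$. Chains and loops. An $n$-chain has boxes $b_1,\dots,b_n$ and lines $e_0,\dots,e_n$, where $e_i$ borders $b_i,b_{i+1}$ for $1\le i\le n-1$, $e_0$ borders only $b_1$ and $e_n$ borders only $b_n$. An $n$-loop ($n\ge4$) has boxes $b_1,\dots,b_n$ and lines $e_1,\dots,e_n$, $e_i$ bordering $b_i,b_{i+1}$ (indices mod $n$). A simple loony endgame is a finite (possibly empty) disjoint union of chains of length at least 3 and loops of even length at least 4. Opening a component $Z$ of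 it means drawing a line of $Z$; $v(G;Z)$ denotes $v(G;m)$ for any line $m$ of $Z$ (it does not depend on the line). *)

(* Defs.v *)
From HB Require Import structures.
From mathcomp Require Import all_boot all_order all_algebra.

Set Implicit Arguments.
Unset Strict Implicit.
Unset Printing Implicit Defensive.

Import Order.TTheory GRing.Theory Num.Theory.

Record position := Position {
  box : finType;
  line : finType;
  border : line -> {set box};
  border_card : forall l : line, 0 < #|border l| <= 2;
  box_card : forall b : box, 0 < #|[set l | b \in border l]| <= 4 }.

Section Play.

Variable G : position.

(* The positions reached during play from G are represented by the set S of
   lines of G that are still undrawn; G itself is S = [set: line G]. *)
Implicit Types (S : {set line G}) (m : line G).

Definition claimed S m : {set box G} :=
  [set b in border m | [forall l in S :\ m, b \notin border l]].

(* v(S; m), given the value w of the position S :\ m *)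
Definition outcome S m (w : int) : int :=
  if 0 < #|claimed S m| then (w - #|claimed S m|%:Z)%R else (- w)%R.

(* The value is defined by recursion on a bound n on the number of undrawn
   lines. The picked move m0 only provides the default element required by
   the iterated minimum over the nonempty set S. *)
Fixpoint value_rec (n : nat) S : int :=
  if n is n'.+1 then
    let f m := outcome S m (value_rec n' (S :\ m)) in
    if [pick m in S] is Some m0 then \big[Order.min/f m0]_(m in S) f m
    else 0%R
  else 0%R.

Definition value S : int := value_rec #|S| S.

Definition move_value S m : int := outcome S m (value (S :\ m)).

Lemma value_set0 : value set0 = 0%R.
Proof. by rewrite /value cards0. Qed.

Lemma valueE S :
  value S = if [pick m in S] is Some m0
            then \big[Order.min/move_value S m0]_(m in S) move_value S m
            else 0%R.
Proof.
rewrite {1}/value; case DS: #|S| => [|n] /=.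
  by case: pickP => // m; rewrite (cards0_eq DS) inE.
have Dn m : m \in S -> value_rec n (S :\ m) = value (S :\ m).
  by move=> Sm; rewrite /value; move: DS; rewrite (cardsD1 m) Sm add1n => -[->].
case: pickP => // m0 Sm0; rewrite /move_value Dn //.
by apply: eq_bigr => m Sm; rewrite Dn.
Qed.

Lemma value_le S m : m \in S -> (value S <= move_value S m)%R.
Proof.
move=> Sm; rewrite valueE; case: pickP => [m0 _|/(_ m)]; last by rewrite Sm.
exact: bigmin_le_cond.
Qed.

Lemma value_attained S :
  S != set0 -> exists2 m, m \in S & value S = move_value S m.
Proof.
case/set0Pn=> m Sm; rewrite valueE; case: pickP => [m0 Sm0|/(_ m)]; last first.
  by rewrite Sm.
apply: (big_ind (fun x : int => exists2 m, m \in S & x = move_value S m)).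
- by exists m0.
- by move=> x y Px Py; rewrite /Order.min; case: ifP.
- by move=> i Si; exists i.
Qed.

End Play.

Definition optimal_move (G : position) (m : line G) : Prop :=
  move_value [set: line G] m = value [set: line G].

(* The lines in X, with the boxes they border, form an n-chain that is a
   component of G: the last condition says that no line outside X borders one
   of its boxes. Boxes are numbered from 0, so e i borders the boxes b (i - 1)
   and b i, whenever these exist. *)
Definition chain_component (G : position) (n : nat) (X : {set line G}) : Prop :=
  exists (b : 'I_n -> box G) (e : 'I_n.+1 -> line G),
    [/\ injective b /\ injective e,
        X = [set e i | i : 'I_n.+1],
        forall i : 'I_n.+1,
          border (e i) = [set b j | j : 'I_n & (j.+1 == i) || (j == i :> nat)]
      & forall (l : line G) (j : 'I_n), b j \in border l -> l \in X].

(* ordS is the cyclic successor i |-> i + 1 mod n *)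
Definition loop_component (G : position) (n : nat) (X : {set line G}) : Prop :=
  4 <= n /\
  exists (b e : 'I_n -> _),
    [/\ injective b /\ injective e,
        X = [set e i | i : 'I_n],
        forall i : 'I_n, border (e i) = [set b i; b (ordS i)]
      & forall (l : line G) (j : 'I_n), b j \in border l -> l \in X].

(* Distinct parts of P share no box since their boxes are bordered by no line
   outside the part, and the parts cover all boxes since every box of a
   position is bordered by some line. *)
Definition simple_loony_endgame (G : position) : Prop :=
  exists2 P : {set {set line G}},
    partition P [set: line G]
  & forall X, X \in P ->
      (exists2 n, 3 <= n & chain_component n X) \/
      (exists2 n, ~~ odd n & loop_component n X).

(* Main.v *)
(* Suppose every box has two lines, and let w be the value of the union of the
   untouched components. If some components have been opened and have n boxes
   left, the player to move can take all of them and score n - w. He can also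
   keep control, leaving the last two boxes of a run that still has an end line
   of a chain (score n + w - 4), or else the last four boxes of a run of at
   least four boxes (score n + w - 8). By induction on the number of lines, the
   best available option is the exact score of the position. Hence opening a
   chain or a loop with n boxes in an unopened position, whose other components
   have value x, is worth n - 2 + |x - 2| or n - 4 + |x - 4|.

   It remains to see that opening the loops in increasing order of length, then
   the chains in any order, is the optimal line of the resulting game on lists
   of lengths. Without 3-chains, a nonempty union of chains of lengths c has
   value 4 + sum (c - 4), and the comparisons follow since
   x |-> n - 4 + |x - 4| is 1-Lipschitz. *)

Require Import Defs.
From mathcomp Require Import all_boot all_order all_algebra zify.

Set Implicit Arguments.
Unset Strict Implicit.
Unset Printing Implicit Defensive.

Import Order.TTheory GRing.Theory Num.Theory.

(** * Arithmetic of the game on lists of loop and chain lengths *)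

Section LoopChainArithmetic.

Local Open Scope ring_scope.

Definition open_loop (n : nat) (x : int) : int := n%:Z - 4 + `|x - 4|.

Definition open_chain (n : nat) (x : int) : int := n%:Z - 2 + `|x - 2|.

(** The closed formula would give 4 on the empty list, where the value is 0. This jump makes the
    last remaining chain a special case below. *)
Definition chains_value (cs : seq nat) : int :=
  if cs is [::] then 0 else 4 + \sum_(c <- cs) (c%:Z - 4).

Definition loops_value (x : int) (ls : seq nat) : int := foldr open_loop x ls.

Lemma open_loop_lipschitz n x y : `|open_loop n x - open_loop n y| <= `|x - y|.
Proof. rewrite /open_loop; lia. Qed.

Lemma loops_value_lipschitz ls x y :
  `|loops_value x ls - loops_value y ls| <= `|x - y|.
Proof.
by elim: ls => //= n s IHs; apply: le_trans (open_loop_lipschitz _ _ _) IHs.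
Qed.

Definition loop_length (n : nat) : bool := (3 < n)%N && ~~ odd n.

Lemma loops_value_ge x n s : n%:Z - 4 <= loops_value x (n :: s).
Proof. rewrite /= /open_loop; lia. Qed.

(** For a position with a single chain, of length 4, this says that the loops should be opened
    before the chain. The loops turn the start values 4 and 0 into closely linked numbers, and the
    invariant lists the three possible links. *)
Lemma loops_value4_le s : sorted leq s -> all loop_length s ->
  loops_value 4 s <= 2 + `|loops_value 0 s - 2|.
Proof.
case: s => [|n s] //.
suff inv : path leq n s -> all loop_length (n :: s) ->
  exists k : nat,
  let x := loops_value 4 (n :: s) in let y := loops_value 0 (n :: s) in
  x = (2 * k)%N :> int /\
  (y = x + 4 \/ y = x \/ x = 4 /\ y = 0 /\ n = 4%N).
  by move=> srt lens; have [k] := inv srt lens; cbv zeta; lia.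
elim: s n => [|h s IHs] n.
  move=> _ /=; rewrite /loop_length /open_loop => lenn.
  exists ((n - 4)./2)%N; lia.
move=> /andP[le_nh srt] /andP[lenn lens].
have [k] := IHs h srt lens; have := loops_value_ge 4 h s.
have unfoldF t :
  loops_value t [:: n, h & s] = open_loop n (loops_value t (h :: s)) by [].
cbv zeta; rewrite !unfoldF {unfoldF}.
move: (loops_value 4 _) (loops_value 0 _) => x y; rewrite /open_loop.
move: lenn; rewrite /loop_length => lenn xge [Dx inv].
(* An even [x] below 4 is 0 or 2. If [x = 0], then [h - 4 <= x] forces [h = 4], and sortedness gives
   [n = 4]; a link [y = x + 4] then becomes the exceptional pair 4, 0, which a further 4-loop turns
   back into 0, 4. The witnesses are half of the new [x], according to the sign of [x - 4]. *)
case: (ltnP k 2) => k2; [exists (n./2 - k)%N | exists (k + n./2 - 4)%N].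
  lia.
  lia.
Qed.

(** Removing a chain subtracts [c - 4], except that with the last chain the constant 4 goes as well.
    In the other case the terms left are nonnegative, and the resulting bound 4 resolves the
    absolute value in [open_chain]. *)
Lemma chains_value_rem c cs : all (leq 4) cs -> c \in cs ->
  rem c cs = [::] /\ chains_value cs = c%:Z \/
  4 <= chains_value (rem c cs) /\
    chains_value cs = chains_value (rem c cs) + (c%:Z - 4).
Proof.
move=> lens c_cs; have pcs := perm_to_rem c_cs.
have -> : chains_value cs = 4 + (c%:Z - 4 + \sum_(d <- rem c cs) (d%:Z - 4)).
  have -> : chains_value cs = 4 + \sum_(d <- cs) (d%:Z - 4).
    by case: cs c_cs {lens pcs}.
  by rewrite (perm_big _ pcs) big_cons.
have : all (leq 4) (rem c cs).
  by apply/allP=> x /mem_rem; apply/allP.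
case: (rem c cs) => [|d s] lens'; [left|right].
  by rewrite big_nil; split=> //; lia.
rewrite /chains_value; set t := \sum_(_ <- _) _.
suff : 0 <= t by lia.
rewrite /t big_seq; apply: sumr_ge0 => i /(allP lens').
by rewrite subr_ge0 lez_nat.
Qed.

(** If other chains remain, raising the start value by [c - 4] raises the result by at most as much,
    and [v - 4 <= |v - 2| - 2] for every [v]. For the last chain, the Lipschitz bound reduces length
    [c] to length 4, where [loops_value4_le] applies. *)
Lemma loops_value_rem_chain ls cs c :
  sorted leq ls -> all loop_length ls -> all (leq 4) cs -> c \in cs ->
  loops_value (chains_value cs) ls <=
  open_chain c (loops_value (chains_value (rem c cs)) ls).
Proof.
move=> srt lens lenc c_cs; have c4 := allP lenc _ c_cs.
rewrite /open_chain.
have [[-> ->]|[ge4 ->]] := chains_value_rem lenc c_cs.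
  have := loops_value4_le srt lens; have := loops_value_lipschitz ls c%:Z 4.
  rewrite /=; lia.
move: ge4; move: (chains_value _) => x ge4.
have := loops_value_lipschitz ls (x + (c%:Z - 4)) x; lia.
Qed.

Lemma loops_value_rem_loop x ls z :
  sorted leq ls -> all loop_length ls -> z \in ls ->
  loops_value x ls <= open_loop z (loops_value x (rem z ls)).
Proof.
(* If z = 6, the loops shorter than z are 4-loops, and x |-> `|x - 4| preserves
   the second bound. *)
suff inv : sorted leq ls -> all loop_length ls -> z \in ls ->
  let p := loops_value x ls in let q := loops_value x (rem z ls) in
  p <= open_loop z q /\ (z = 6%N -> `|p - `|q - 4| | <= 2).
  by move=> srt lens zs; have [] := inv srt lens zs.
elim: ls => //= a s IHs srt /andP[lena lens].
rewrite inE eq_sym; case: eqVneq => [-> _ | az /= zs] /=.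
  split=> // ->; rewrite /open_loop; lia.
have [] := IHs (path_sorted srt) lens zs.
have az' : (a < z)%N.
  have := order_path_min leq_trans srt.
  by move=> /allP /(_ _ zs); lia.
have : a%:Z - 4 <= loops_value x s.
  move: srt zs; case: (s) => //= h t /andP[ah _] _.
  rewrite /open_loop; lia.
have := allP lens _ zs; move: lena.
move: (loops_value x s) (loops_value x (rem z s)) => p q.
(* For [p >= 4] the first bound carries over. Otherwise [p >= a - 4] bounds the new left side by 4,
   which suffices for [z >= 8]; the case [z = 6] leaves [a = 4] and uses the second bound. *)
rewrite /loop_length /open_loop; lia.
Qed.

End LoopChainArithmetic.

Lemma set3P (T : finType) (x a b c : T) :
  reflect [\/ x = a, x = b | x = c] (x \in [set a; b; c]).
Proof.
rewrite !inE -orbA.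
apply: (iffP or3P).
  by case=> /eqP; [constructor 1|constructor 2|constructor 3].
by case=> /eqP; [constructor 1|constructor 2|constructor 3].
Qed.

(** * Positions reached from a union of connected parts in which every box has two lines *)

Section PartiallyOpenedPositions.

Variables (G : position) (P : {set {set line G}}).

Implicit Types (S A X : {set line G}) (a b c l m o r s t : line G).
Implicit Types (p q x y : box G).

Hypothesis partP : partition P [set: line G].
Hypothesis box_lines2 : forall x : box G, #|[set l | x \in border l]| = 2.
Hypothesis adjacent_lines : forall X l r x,
  X \in P -> l \in X -> x \in border l -> x \in border r -> r \in X.
Hypothesis connected_parts : forall X A l,
    X \in P -> l \in X -> l \in A ->
    (forall s t x, s \in A -> x \in border s -> x \in border t -> t \in A) ->
  X \subset A.

Let mem_part l : l \in pblock P l.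
Proof. by rewrite mem_pblock (cover_partition partP) inE. Qed.

Let part_in l : pblock P l \in P.
Proof. by rewrite pblock_mem // (cover_partition partP) inE. Qed.

Let partE X l : X \in P -> l \in X -> pblock P l = X.
Proof. by apply: def_pblock; case/and3P: partP. Qed.

Let part_adj l r x : x \in border l -> x \in border r -> pblock P l = pblock P r.
Proof.
move=> xl xr; apply/esym/partE; first exact: part_in.
exact: adjacent_lines (part_in l) (mem_part l) xl xr.
Qed.

Let lines_of_box l r t x :
  l != r -> x \in border l -> x \in border r -> x \in border t ->
  t = l \/ t = r.
Proof.
move=> lr xl xr xt.
have D : [set l; r] = [set s | x \in border s].
  apply/eqP; rewrite eqEcard box_lines2 cards2 lr andbT.
  by apply/subsetP=> s /set2P[]->; rewrite inE.
have: t \in [set l; r] by rewrite D inE.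
by case/set2P; [left | right].
Qed.

Let other_line l x : x \in border l -> exists2 r, r != l & x \in border r.
Proof.
move=> xl; have := box_lines2 x; rewrite (cardsD1 l) inE xl add1n => -[D].
have /card_gt0P[r] : 0 < #|[set s | x \in border s] :\ l| by rewrite D.
by rewrite !inE => /andP[rl xr]; exists r.
Qed.

Let other_box l x : x \in border l -> border l != [set x] ->
  exists2 y, y != x & y \in border l.
Proof.
move=> xl ne; have /subsetPn[y yl] : ~~ (border l \subset [set x]).
  by apply: contra ne; rewrite eqEsubset sub1set xl andbT.
by rewrite inE => yx; exists y.
Qed.

Let borderE l x y : x != y -> x \in border l -> y \in border l ->
  border l = [set x; y].
Proof.
move=> xy xl yl; apply/esym/eqP; rewrite eqEcard cards2 xy.
by case/andP: (border_card l) => _ ->; rewrite andbT subUset !sub1set xl.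
Qed.

(** * Opened and untouched lines, and the candidate score *)

Definition opened S := [set l in S | ~~ (pblock P l \subset S)].

Definition unopened S := [set l in S | pblock P l \subset S].

Definition boxes_of A : {set box G} := \bigcup_(l in A) border l.

(* In the lines of a run, loose_end detects an end line of a chain followed by
   another line, and triple detects four boxes joined by three lines. *)
Definition loose_end A : bool :=
  [exists o in A, exists r in A, exists x : box G,
     [&& o != r, border o == [set x] & x \in border r]].

Definition triple A : bool :=
  [exists a in A, exists b in A, exists c in A,
   exists p : box G, exists q : box G,
     [&& p != q, uniq [:: a; b; c], p \in border a, p \in border b,
         q \in border b & q \in border c]].

Lemma loose_endP A : reflect
  (exists o r x, [/\ o \in A, r \in A, o != r, border o = [set x]
     & x \in border r]) (loose_end A).
Proof.
apply: (iffP exists_inP).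
  case=> o oA /exists_inP[r rA /existsP[x /and3P[ne /eqP Do xr]]].
  by exists o, r, x.
case=> o [r [x [oA rA ne Do xr]]]; exists o => //.
apply/exists_inP; exists r => //.
by apply/existsP; exists x; rewrite ne Do eqxx.
Qed.

Lemma tripleP A : reflect
  (exists a b c p q, [/\ [/\ a \in A, b \in A & c \in A], p != q,
      [/\ a != b, a != c & b != c], p \in border a /\ p \in border b
     & q \in border b /\ q \in border c]) (triple A).
Proof.
apply: (iffP exists_inP).
  case=> a aA /exists_inP[b bA /exists_inP[c cA /existsP[p /existsP[q]]]].
  case/and5P=> pq; rewrite /= !inE andbT => /andP[/norP[ab ac] bc] pa pb.
  case/andP=> qb qc.
  by exists a, b, c, p, q.
case=> a [b [c [p [q [[aA bA cA] pq [ab ac bc] [pa pb] [qb qc]]]]]].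
exists a => //; apply/exists_inP; exists b => //.
apply/exists_inP; exists c => //.
apply/existsP; exists p; apply/existsP; exists q.
by rewrite pq pa pb qb qc /= !inE negb_or ab ac bc.
Qed.

Lemma loose_endS A A' : A \subset A' -> loose_end A -> loose_end A'.
Proof.
move=> /subsetP sAA' /loose_endP[o [r [x [oA rA ne Do xr]]]].
by apply/loose_endP; exists o, r, x; rewrite !sAA'.
Qed.

Lemma tripleS A A' : A \subset A' -> triple A -> triple A'.
Proof.
move=> /subsetP sAA' /tripleP[a [b [c [p [q [[aA bA cA] *]]]]]].
by apply/tripleP; exists a, b, c, p, q; rewrite !sAA'.
Qed.

(** [|w - 2| - 2] is the larger of [- w] and [w - 4], and [|w - 4| - 4] the larger of [- w] and
    [w - 8]: taking everything against giving away two or four boxes. When both gifts are possible,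
    the cheaper one counts. *)
Definition control_bonus (h d : bool) (w : int) : int :=
  (if h then `|w - 2| - 2 else if d then `|w - 4| - 4 else - w)%R.

(** The net score of the player to move, hence opposite in sign to [value]. *)
Definition score S : int :=
  (#|boxes_of (opened S)|%:Z +
   control_bonus (loose_end (opened S)) (triple (opened S))
                 (value (unopened S)))%R.

Let openedP S l : l \in opened S -> l \in S /\ ~~ (pblock P l \subset S).
Proof. by rewrite inE => /andP. Qed.

Let opened_adj S l r x : l \in opened S -> x \in border l -> x \in border r ->
  r \in S -> r \in opened S.
Proof. by rewrite !inE => /andP[_ nS] xl xr ->; rewrite -(part_adj xl xr). Qed.

(** By connectedness a closed set would contain a whole part, but a part with opened lines has lost
    a line. This replaces reasoning on paths and cycles: it excludes every configuration of opened
    lines that closes up on itself. *)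
Let not_closed S A l : A \subset opened S -> l \in A ->
  ~ (forall s t x, s \in A -> x \in border s -> x \in border t -> t \in A).
Proof.
move=> /subsetP sAS lA clA.
have [_ /negP[]] := openedP (sAS l lA).
apply: subset_trans (connected_parts (part_in l) (mem_part l) lA clA) _.
by apply/subsetP=> r /sAS /openedP[].
Qed.

Let boundary S A l : A \subset opened S -> l \in A ->
  exists s t x, [/\ s \in A, x \in border s, x \in border t & t \notin A].
Proof.
move=> sAS lA.
have [/existsP[s /existsP[t /existsP[x /and4P[*]]]]|no_exit] :=
  boolP [exists s, exists t, exists x : box G,
          [&& s \in A, x \in border s, x \in border t & t \notin A]].
  by exists s, t, x.
case: (not_closed sAS lA) => s t x sA xs xt; apply: contraR no_exit => tA.
apply/existsP; exists s; apply/existsP; exists t; apply/existsP; exists x.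
exact/and4P.
Qed.

Let mem_claimed S m l x : x \in border m -> l != m -> x \in border l ->
  (x \in claimed S m) = (l \notin S).
Proof.
move=> xm lm xl; rewrite inE xm /=; apply/forall_inP/idP => [noS|nSl r].
  by apply: contraL xl => Sl; apply: noS; rewrite !inE lm.
rewrite !inE => /andP[rm Sr]; apply: contra nSl => xr.
by have [Dr|Dr] := lines_of_box lm xl xm xr; [rewrite -Dr|case/eqP: rm].
Qed.

Let claimed_gt0 S m l x : x \in border m -> l != m -> x \in border l ->
  l \notin S -> 0 < #|claimed S m|.
Proof.
move=> xm lm xl nSl; apply/card_gt0P; exists x.
by rewrite (mem_claimed _ xm lm xl).
Qed.

Let claimed_eq0 S m :
  (forall x, x \in border m -> exists r, [/\ r != m, x \in border r & r \in S]) ->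
  #|claimed S m| = 0.
Proof.
move=> noclaim; apply/eqP; rewrite cards_eq0; apply/eqP/setP=> x.
rewrite in_set0; apply/negbTE/negP => xcl.
have xm : x \in border m by move: xcl; rewrite inE => /andP[].
have [r [rm xr Sr]] := noclaim x xm.
by move: xcl; rewrite (mem_claimed S xm rm xr) Sr.
Qed.

Let claimed0P S m x : #|claimed S m| = 0 -> x \in border m ->
  exists r, [/\ r != m, x \in border r & r \in S].
Proof.
move=> cl0 xm; have [r rm xr] := other_line xm; exists r; split=> //.
by apply: contraT => /(claimed_gt0 xm rm xr); rewrite cl0.
Qed.

Lemma opened_draw S m : m \in opened S -> opened (S :\ m) = opened S :\ m.
Proof.
move=> oSm; have [_ nSm] := openedP oSm.
apply/setP=> l; rewrite !inE; case: (eqVneq l m) => //= lm.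
case Sl: (l \in S) => //=; rewrite subsetD1.
case sS: (pblock P l \subset S) => //=.
rewrite negbK; apply: contraNF nSm => ml; move: sS.
by rewrite -(partE (part_in l) ml) => ->.
Qed.

Lemma unopened_draw S m : m \in opened S -> unopened (S :\ m) = unopened S.
Proof.
move=> oSm; have [_ nSm] := openedP oSm.
apply/setP=> l; rewrite !inE; case: (eqVneq l m) => [-> /=|lm /=].
  by rewrite (negbTE nSm) andbF.
case Sl: (l \in S) => //=; rewrite subsetD1.
case sS: (pblock P l \subset S) => //=; apply: contraNN nSm => ml.
by rewrite (partE (part_in l) ml).
Qed.

(** A box of [m] that is not claimed keeps its other line, which is again opened, so only claimed
    boxes disappear. *)
Lemma boxes_draw S m : m \in opened S ->
  #|boxes_of (opened S)| = #|claimed S m| + #|boxes_of (opened (S :\ m))|.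
Proof.
move=> oSm; rewrite opened_draw // -(cardsID (claimed S m)).
congr (_ + _); congr #|pred_of_set _|; apply/setP=> x.
  rewrite in_setI andb_idl // => xcl; apply/bigcupP; exists m => //.
  by move: xcl; rewrite inE => /andP[].
rewrite in_setD.
apply/andP/bigcupP=> [[nxcl /bigcupP[l oSl xl]]|[l /setD1P[lm oSl] xl]].
  case: (eqVneq l m) => lm; last by exists l; rewrite // in_setD1 lm.
  subst l; have [r rm xr] := other_line xl; exists r => //.
  rewrite (mem_claimed S xl rm xr) negbK in nxcl.
  by rewrite in_setD1 rm (opened_adj oSm xl xr).
split; last by apply/bigcupP; exists l.
apply/negP => xcl; have xm : x \in border m by move: xcl; rewrite inE => /andP[].
by move: xcl; rewrite (mem_claimed S xm lm xl); case/openedP: oSl => ->.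
Qed.

(** Otherwise [o] and [r] would fill a whole part, from which no line has been drawn. *)
Let loose_end_other S o r x : o \in opened S -> r \in opened S -> o != r ->
  border o = [set x] -> x \in border r ->
  exists2 y, y != x & y \in border r.
Proof.
move=> oS rS ne Do xr; apply: other_box => //; apply/eqP=> Dr.
have sub : [set o; r] \subset opened S by rewrite subUset !sub1set oS rS.
apply: (not_closed sub (set21 o r)) => s t y /set2P[]->;
  rewrite ?Do ?Dr inE => /eqP-> xt;
  have xo : x \in border o by rewrite Do set11.
  by have [->|->] := lines_of_box ne xo xr xt; rewrite ?set21 ?set22.
by have [->|->] := lines_of_box ne xo xr xt; rewrite ?set21 ?set22.
Qed.

Lemma loose_end_boxes S : loose_end (opened S) -> 2 <= #|boxes_of (opened S)|.
Proof.
case/loose_endP=> o [r [x [oS rS ne Do xr]]].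
have [y yx yr] := loose_end_other oS rS ne Do xr.
rewrite -[2](_ : #|[set y; x]| = 2); last by rewrite cards2 yx.
by apply: subset_leq_card; rewrite subUset !sub1set;
   apply/andP; split; apply/bigcupP; exists r.
Qed.

(** Without loose ends, [a] and [c] reach beyond [p] and [q]. The two far boxes differ, since
    otherwise the three lines would form a closed cycle. By the last clause the triple can be left
    only through a far box. *)
Let triple_ends S a b c p q : ~~ loose_end (opened S) ->
  [/\ a \in opened S, b \in opened S & c \in opened S] -> p != q ->
  [/\ a != b, a != c & b != c] -> p \in border a /\ p \in border b ->
  q \in border b /\ q \in border c ->
  exists p' q', [/\ border a = [set p'; p], border b = [set p; q],
    border c = [set q'; q], uniq [:: p'; p; q; q'] &
    forall s t x, s \in [set a; b; c] -> x \in border s -> x \in border t ->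
      t \in [set a; b; c] \/ x = p' \/ x = q'].
Proof.
move=> noloose [aS bS cS] pq [ab ac bc] [pa pb] [qb qc].
have [p' p'p p'a] : exists2 y, y != p & y \in border a.
  apply: other_box => //; apply: contra noloose => /eqP Da.
  by apply/loose_endP; exists a, b, p.
have [q' q'q q'c] : exists2 y, y != q & y \in border c.
  apply: other_box => //; apply: contra noloose => /eqP Dc.
  by apply/loose_endP; exists c, b, q; rewrite eq_sym.
have Da := borderE p'p p'a pa; have Db := borderE pq pb qb.
have Dc := borderE q'q q'c qc.
have p'q : p' != q.
  apply/eqP=> Dp'; rewrite Dp' in p'a.
  by have [D|D] := lines_of_box bc qb qc p'a; [case/eqP: ab | case/eqP: ac].
have q'p : q' != p.
  apply/eqP=> Dq'; rewrite Dq' in q'c.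
  have [D|D] := lines_of_box ab pa pb q'c; first by case/eqP: ac.
  by case/eqP: bc.
have exit s t x : s \in [set a; b; c] -> x \in border s -> x \in border t ->
    t \in [set a; b; c] \/ x = p' \/ x = q'.
  move=> sabc xs xt; suff: x = p \/ x = q \/ x = p' \/ x = q'.
    case=> [Dx|[Dx|]]; rewrite ?Dx in xt *; last by right.
      by left; have [->|->] := lines_of_box ab pa pb xt; rewrite !inE eqxx ?orbT.
    by left; have [->|->] := lines_of_box bc qb qc xt; rewrite !inE eqxx ?orbT.
  by move: sabc xs => /set3P[]->; rewrite ?Da ?Db ?Dc => /set2P[]->; auto.
have p'q' : p' != q'.
  apply/eqP=> Dp'; have sub : [set a; b; c] \subset opened S.
    by apply/subsetP=> l /set3P[]->.
  have a_abc : a \in [set a; b; c] by rewrite !inE eqxx.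
  apply: (not_closed sub a_abc) => s t x sabc xs xt.
  have [//|Dx] := exit s t x sabc xs xt.
  have {Dx} Dx : x = p' by case: Dx => // ->.
  rewrite -Dp' in q'c; rewrite Dx in xt.
  by have [->|->] := lines_of_box ac p'a q'c xt; rewrite !inE eqxx ?orbT.
exists p', q'; split=> //.
by rewrite /= !inE !negb_or p'p p'q p'q' pq eq_sym q'p eq_sym q'q.
Qed.

Lemma triple_boxes S : ~~ loose_end (opened S) -> triple (opened S) ->
  4 <= #|boxes_of (opened S)|.
Proof.
move=> noloose /tripleP[a [b [c [p [q [abcS pq abc pab qbc]]]]]].
have [p' [q' [Da Db Dc Uniq _]]] := triple_ends noloose abcS pq abc pab qbc.
case: abcS => aS bS cS.
rewrite -[4]/(size [:: p'; p; q; q']) -(card_uniqP Uniq).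
apply: subset_leq_card; apply/subsetP=> x; rewrite !inE.
case/or4P=> /eqP->; apply/bigcupP.
- by exists a; rewrite ?Da ?set21.
- by exists a; rewrite ?Da ?set22.
- by exists c; rewrite ?Dc ?set22.
by exists c; rewrite ?Dc ?set21.
Qed.

(** Each box of [m] keeps a second undrawn line. If [m] borders one box, this gives a loose end; if
    two, a triple with [m] in the middle, whose outer lines differ because two opened lines cannot
    form a cycle. *)
Lemma quiet_move S m : m \in opened S -> #|claimed S m| = 0 ->
  loose_end (opened S) || triple (opened S).
Proof.
move=> mS cl0; have [p pm] : exists p, p \in border m.
  by apply/card_gt0P; case/andP: (border_card m).
have [a [am pa Sa]] := claimed0P cl0 pm; have aS := opened_adj mS pm pa Sa.
case: (eqVneq (border m) [set p]) => [Dm|ne].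
  by apply/orP; left; apply/loose_endP; exists m, a, p; rewrite eq_sym.
have [q qp qm] := other_box pm ne.
have [c [cm qc Sc]] := claimed0P cl0 qm; have cS := opened_adj mS qm qc Sc.
have Dm := borderE qp qm pm.
apply/orP; right; apply/tripleP; exists a, m, c, p, q; split=> //.
  by rewrite eq_sym.
split=> //; last by rewrite eq_sym.
apply/eqP=> Dac; subst c.
have Da := borderE qp qc pa.
have sub : [set a; m] \subset opened S by rewrite subUset !sub1set aS mS.
apply: (not_closed sub (set21 a m)) => s t x sam xs xt.
have {xs} : x \in [set q; p] by case/set2P: sam xs => ->; rewrite ?Da ?Dm.
case/set2P=> Dx; rewrite Dx in xt.
  by have [->|->] := lines_of_box am qc qm xt; rewrite ?set21 ?set22.
by have [->|->] := lines_of_box am pa pm xt; rewrite ?set21 ?set22.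
Qed.

Local Open Scope ring_scope.

(** Claimed boxes are credited to the player, so the count of opened boxes before the move stays in
    the formula; only the bonus changes, and the sign if nothing is claimed. *)
Lemma draw_opened S m : m \in opened S -> - value (S :\ m) = score (S :\ m) ->
  - move_value S m =
    if (0 < #|claimed S m|)%N then
      #|boxes_of (opened S)|%:Z +
      control_bonus (loose_end (opened S :\ m)) (triple (opened S :\ m))
        (value (unopened S))
    else - (#|boxes_of (opened S)|%:Z +
      control_bonus (loose_end (opened S :\ m)) (triple (opened S :\ m))
        (value (unopened S))).
Proof.
move=> mS; rewrite /move_value /outcome /score (boxes_draw mS) opened_draw //.
rewrite unopened_draw //; move: (control_bonus _ _ _) (value (S :\ m)) => v w.
case: ifP; lia.
Qed.

Lemma control_bonus_mono (h d h' d' : bool) w : (h ==> h') -> (d ==> d') ->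
  control_bonus h d w <= control_bonus h' d' w.
Proof. rewrite /control_bonus; case: h h' d d' => [] [] [] [] //= _ _; lia. Qed.

Lemma control_bonus_ge (h d : bool) w : - w <= control_bonus h d w.
Proof. rewrite /control_bonus; case: h d => [] [] //=; lia. Qed.

(** A capture can only destroy loose ends and triples, which never raises the bonus. With [n] opened
    boxes and untouched value [w], a quiet move yields at most [w - n], which is at most [n + w - 4]
    if [n >= 2] and at most [n + w - 8] if [n >= 4]. *)
Lemma draw_opened_le S m : m \in opened S ->
  - value (S :\ m) = score (S :\ m) -> - move_value S m <= score S.
Proof.
move=> mS IH; rewrite (draw_opened mS IH) /score.
have := @control_bonus_mono (loose_end (opened S :\ m)) (triple (opened S :\ m))
  (loose_end (opened S)) (triple (opened S)) (value (unopened S)).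
rewrite (introT implyP (@loose_endS _ _ (subD1set _ _))).
rewrite (introT implyP (@tripleS _ _ (subD1set _ _))) => /(_ isT isT).
have := @quiet_move S m mS; have := @triple_boxes S; have := @loose_end_boxes S.
rewrite /control_bonus.
case: (loose_end (opened S)) => /=.
  by move=> /(_ isT) two _ _; do ?case: ifP; lia.
move=> _; case: (triple (opened S)) => [|] /=.
  by move=> /(_ isT isT) four _; do ?case: ifP; lia.
(* With neither pattern, every move on an opened line is a capture. *)
move=> _; case: posnP => [cl0 /(_ cl0) //|pos _].
lia.
Qed.

Local Close Scope ring_scope.

(** * Capturing moves and moves that keep control *)

Let capture S s t x : s \in opened S -> x \in border s -> x \in border t ->
  t \notin S -> 0 < #|claimed S s|.
Proof.
move=> sS xs xt nt; apply: claimed_gt0 (xs) _ xt (nt).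
by apply: contraNneq nt => ->; case/openedP: sS.
Qed.

Let boundary_opened S l : l \in opened S ->
  exists s t x, [/\ s \in opened S, x \in border s, x \in border t & t \notin S].
Proof.
move=> lS; have [s [t [x [sS xs xt nt]]]] := boundary (subxx (opened S)) lS.
by exists s, t, x; split=> //; apply: contra nt; apply: opened_adj sS xs xt.
Qed.

Lemma capturing_move S : opened S != set0 ->
  exists2 m, m \in opened S & 0 < #|claimed S m|.
Proof.
case/set0Pn=> l /boundary_opened[s [t [x [sS xs xt nt]]]].
by exists s => //; apply: capture sS xs xt nt.
Qed.

Lemma loose_end_card A : loose_end A -> 1 < #|A|.
Proof.
case/loose_endP=> o [r [_ [oA rA ne _ _]]].
by rewrite (cardsD1 o) oA (cardsD1 r) !inE eq_sym ne rA.
Qed.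

Lemma triple_card A : triple A -> 2 < #|A|.
Proof.
case/tripleP=> a [b [c [_ [_ [[aA bA cA] _ [ab ac bc] _ _]]]]].
rewrite (cardsD1 a) aA (cardsD1 b) (cardsD1 c) !inE bA cA.
by rewrite (eq_sym b a) (eq_sym c b) (eq_sym c a) ab ac bc.
Qed.

(** Used with [A] a loose end or a triple, once captures elsewhere have run out. An opened line
    outside [A] would lead to a boundary either at a drawn line, giving a capture, or at an undrawn
    line of [A], against the first premise. *)
Let opened_sub_lines S A :
  (forall s t x, s \in opened S -> s \notin A -> x \in border s ->
     x \in border t -> t \in A -> t \notin S) ->
  ~~ [exists m in opened S, (m \notin A) && (0 < #|claimed S m|)] ->
  opened S \subset A.
Proof.
move=> no_exit no_capture; apply/subsetP=> l lS; apply: contraT => nlA.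
have lD : l \in opened S :\: A by rewrite in_setD nlA.
have [s [t [x [/setDP[sS nsA] xs xt]]]] := boundary (subsetDl (opened S) A) lD.
rewrite in_setD; have [tS|ntS] := boolP (t \in S); last first.
  case/negP: no_capture; apply/exists_inP; exists s => //.
  by rewrite nsA (capture sS xs xt ntS).
rewrite (opened_adj sS xs xt tS) andbT negbK => tA.
by have := no_exit s t x sS nsA xs xt tA; rewrite tS.
Qed.

(** Captures away from [o] and [r] preserve the loose end. When none is left, only [o] and [r]
    remain, and drawing the end line [o] leaves the two boxes of [r] to the opponent. *)
Lemma loose_end_move S : loose_end (opened S) ->
  (exists m, [/\ m \in opened S, 0 < #|claimed S m|
     & loose_end (opened S :\ m)]) \/
  (exists m, [/\ m \in opened S, #|claimed S m| = 0,
     #|boxes_of (opened S)| <= 2, ~~ loose_end (opened S :\ m)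
     & ~~ triple (opened S :\ m)]).
Proof.
case/loose_endP=> o [r [x [oS rS ne Do xr]]].
have xo : x \in border o by rewrite Do set11.
have [oSS _] := openedP oS; have [rSS _] := openedP rS.
have [/exists_inP[m mS /andP[]]|no_capture] :=
  boolP [exists m in opened S, (m \notin [set o; r]) && (0 < #|claimed S m|)].
  rewrite !inE negb_or => /andP[mo mr] cl; left; exists m; split=> //.
  apply/loose_endP; exists o, r, x; split=> //.
    by rewrite in_setD1 eq_sym mo.
  by rewrite in_setD1 eq_sym mr.
right; exists o.
have [s [t [y [sS ys yt nt]]]] := boundary_opened oS.
(* Both lines of [x] are undrawn, so the box next to the drawn line [t] is another one. *)
have yx : y != x.
  apply/eqP=> Dy; rewrite Dy in yt.
  by have [Dt|Dt] := lines_of_box ne xo xr yt; rewrite Dt ?oSS ?rSS in nt.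
have {sS ys} yr : y \in border r.
  have sor : s \in [set o; r].
    apply: contraR no_capture => nsor; apply/exists_inP; exists s => //.
    by rewrite nsor (capture sS ys yt nt).
  case/set2P: sor ys => -> //; rewrite Do inE => /eqP Dy.
  by rewrite Dy eqxx in yx.
have Dr := borderE yx yr xr.
have sub : opened S \subset [set o; r].
  apply: opened_sub_lines no_capture => s1 t1 z s1S; rewrite !inE negb_or.
  case/andP=> s1o s1r zs1 zt1; have [s1SS _] := openedP s1S.
  have nx : z <> x.
    move=> Dz; rewrite Dz in zs1.
    by have [D|D] := lines_of_box ne xo xr zs1; [case/eqP: s1o|case/eqP: s1r].
  case/orP=> /eqP Dt1; subst t1; first by move: zt1; rewrite Do inE => /eqP.
  move: zt1; rewrite Dr => /set2P[] // Dz; rewrite Dz in zs1.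
  have rt : r != t by apply: contraNneq nt => <-.
  have [D|D] := lines_of_box rt yr yt zs1; first by case/eqP: s1r.
  by rewrite -D s1SS in nt.
have card1 : #|opened S :\ o| <= 1.
  rewrite -(cards1 r); apply: subset_leq_card; rewrite subDset.
  by apply: subset_trans sub _.
split=> //.
- apply: claimed_eq0 => z; rewrite Do inE => /eqP->; exists r.
  by rewrite eq_sym.
- have: #|border r| <= 2 by case/andP: (border_card r).
  apply: leq_trans; apply: subset_leq_card; apply/bigcupsP=> l.
  by move/(subsetP sub)/set2P=> [] ->; rewrite // Do sub1set.
- by apply: contraL card1 => /loose_end_card; rewrite -ltnNge.
by apply: contraL card1 => /triple_card; rewrite -ltnNge; apply: ltnW.
Qed.

(** Captures outside the triple come first. When they have run out, an undrawn neighbour [d] or [e]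
    allows the triple to be shifted by one line, and the line freed at the other end captures. If
    both neighbours are drawn, the middle line [b] splits the last four boxes into two pairs. *)
Lemma triple_move S : ~~ loose_end (opened S) -> triple (opened S) ->
  (exists m, [/\ m \in opened S, 0 < #|claimed S m|
     & triple (opened S :\ m)]) \/
  (exists m, [/\ m \in opened S, #|claimed S m| = 0,
     #|boxes_of (opened S)| <= 4, ~~ loose_end (opened S :\ m)
     & ~~ triple (opened S :\ m)]).
Proof.
move=> noloose /tripleP[a [b [c [p [q [abcS pq abc pab qbc]]]]]].
have [p' [q' [Da Db Dc Uniq exit]]] := triple_ends noloose abcS pq abc pab qbc.
case: abcS abc pab qbc => aS bS cS [ab ac bc] [pa pb] [qb qc].
have [/exists_inP[m mS /andP[]]|no_capture] :=
  boolP [exists m in opened S, (m \notin [set a; b; c]) && (0 < #|claimed S m|)].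
  rewrite !inE !negb_or -andbA !(eq_sym m) => /and3P[ma mb mc] cl.
  left; exists m; split=> //; apply/tripleP; exists a, b, c, p, q.
  by rewrite !in_setD1 ma mb mc aS bS cS.
move: Uniq; rewrite /= !inE !negb_or.
case/and4P=> /and3P[p'p p'q p'q'] /andP[_ pq'] qq' _.
have abc_S l : l \in [set a; b; c] -> l \in S.
  by case/set3P=> ->; [case/openedP: aS|case/openedP: bS|case/openedP: cS].
have p'a : p' \in border a by rewrite Da set21.
have q'c : q' \in border c by rewrite Dc set21.
have [d da p'd] := other_line p'a; have [e ec q'e] := other_line q'c.
have db : d != b.
  by apply: contraTneq p'd => ->; rewrite Db !inE negb_or p'p.
have dc : d != c.
  by apply: contraTneq p'd => ->; rewrite Dc !inE negb_or p'q'.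
have ea : e != a.
  apply: contraTneq q'e => ->.
  by rewrite Da !inE negb_or (eq_sym q') p'q' (eq_sym q') pq'.
have eb : e != b.
  apply: contraTneq q'e => ->.
  by rewrite Db !inE negb_or (eq_sym q') pq' (eq_sym q').
have [s [t [x [sS xs xt nt]]]] := boundary_opened aS.
have sabc : s \in [set a; b; c].
  apply: contraR no_capture => nsabc; apply/exists_inP; exists s => //.
  by rewrite nsabc (capture sS xs xt nt).
have Dx : x = p' \/ x = q'.
  by have [/abc_S|//] := exit s t x sabc xs xt; rewrite (negbTE nt).
have [dS|ndS] := boolP (d \in S).
  left; exists c; split=> //.
    case: Dx => Dx; rewrite Dx in xt; last exact: capture cS q'c xt nt.
    have ad : a != d by rewrite eq_sym.
    have [D|D] := lines_of_box ad p'a p'd xt; last by rewrite D dS in nt.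
    by rewrite D abc_S // !inE eqxx in nt.
  apply/tripleP; exists d, a, b, p', p; rewrite !in_setD1 aS bS dc ac bc.
  by rewrite (opened_adj aS p'a p'd dS) da db.
have [eS|neS] := boolP (e \in S).
  left; exists a; split=> //.
    apply: (capture aS p'a p'd ndS).
  apply/tripleP; exists b, c, e, q, q'; rewrite !in_setD1 bS cS ea.
  rewrite (opened_adj cS q'c q'e eS) !(eq_sym _ a) ab ac bc (eq_sym b) eb.
  by rewrite (eq_sym c) ec.
right; exists b.
have sub : opened S \subset [set a; b; c].
  apply: opened_sub_lines no_capture => s1 t1 z s1S ns1 zs1 zt1 t1abc.
  have [s1SS _] := openedP s1S.
  have [s1abc|Dz] := exit t1 s1 z t1abc zt1 zs1; first by rewrite s1abc in ns1.
  have ad : a != d by rewrite eq_sym. have ce : c != e by rewrite eq_sym.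
  case: Dz => Dz; rewrite Dz in zs1.
    have [D|D] := lines_of_box ad p'a p'd zs1; last by rewrite -D s1SS in ndS.
    by rewrite D !inE eqxx in ns1.
  have [D|D] := lines_of_box ce q'c q'e zs1; last by rewrite -D s1SS in neS.
  by rewrite D !inE eqxx orbT in ns1.
split=> //.
- apply: claimed_eq0 => z; rewrite Db => /set2P[]->; [exists a|exists c].
    by rewrite ab (abc_S a) // !inE eqxx.
  by rewrite eq_sym bc (abc_S c) // !inE eqxx orbT.
- apply: leq_trans (card_size [:: p'; p; q; q']).
  apply: subset_leq_card; apply/bigcupsP=> l.
  by move/(subsetP sub)/set3P=> [] ->; rewrite ?Da ?Db ?Dc;
     apply/subsetP=> z /set2P[]->; rewrite !inE eqxx ?orbT.
- by apply: contra noloose; apply/loose_endS/subD1set.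
have card2 : #|opened S :\ b| <= 2.
  apply: (@leq_trans #|[set a; c]|); last by rewrite cards2 ac.
  apply: subset_leq_card; rewrite subDset; apply: subset_trans sub _.
  by apply/subsetP=> l /set3P[]->; rewrite !inE eqxx ?orbT.
by apply: contraL card2 => /triple_card; rewrite -ltnNge.
Qed.

(** * Moves in untouched components, and the exact score *)

Let unopenedP S l : l \in unopened S -> l \in S /\ pblock P l \subset S.
Proof. by rewrite inE => /andP. Qed.

Lemma unopened_part S m : m \in unopened S -> pblock P m \subset unopened S.
Proof.
case/unopenedP=> _ sS; apply/subsetP=> l lm.
by rewrite inE (subsetP sS) // (partE (part_in m) lm).
Qed.

Lemma opened_unopened S : opened (unopened S) = set0.
Proof.
apply/setP=> l; rewrite inE in_set0; apply/negP=> /andP[/unopened_part->].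
by [].
Qed.

Lemma unopened_id S : unopened (unopened S) = unopened S.
Proof.
apply/setP=> l; rewrite inE; case lS: (l \in unopened S) => //=.
exact: unopened_part.
Qed.

Lemma unopened_eq S : opened S = set0 -> unopened S = S.
Proof.
move=> oS0; apply/setP=> l; have /setP/(_ l) := oS0; rewrite !inE.
by case: (l \in S) => //= /negbFE.
Qed.

Section DrawUnopened.

Variables (S : {set line G}) (m : line G).
Hypothesis mS : m \in unopened S.

Lemma claimed_draw_unopened : #|claimed S m| = 0.
Proof.
have [_ sS] := unopenedP mS.
apply: claimed_eq0 => x xm; have [r rm xr] := other_line xm.
by exists r; split=> //; rewrite (subsetP sS) // (part_adj xm xr).
Qed.

Lemma opened_draw_unopened :
  opened (S :\ m) = opened S :|: (pblock P m :\ m).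
Proof.
have [_ sS] := unopenedP mS; apply/setP=> l; rewrite !inE subsetD1.
case: (eqVneq l m) => [->|lm] /=; first by rewrite sS andbF.
have [lPm|nlPm] := boolP (l \in pblock P m).
  by rewrite orbT (subsetP sS) // (partE (part_in m) lPm) mem_part andbF.
rewrite orbF; case: (l \in S) => //=; congr negb; rewrite andb_idr // => _.
by apply: contra nlPm => ml; rewrite (partE (part_in l) ml).
Qed.

Lemma unopened_draw_unopened : unopened (S :\ m) = unopened S :\: pblock P m.
Proof.
have [_ sS] := unopenedP mS; apply/setP=> l; rewrite !inE subsetD1.
have [lPm|nlPm] /= := boolP (l \in pblock P m).
  by rewrite (partE (part_in m) lPm) mem_part !andbF.
have -> : (l != m) by apply: contraNneq nlPm => ->.
rewrite /=; case: (l \in S) => //=; rewrite andb_idr // => _.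
by apply: contra nlPm => ml; rewrite (partE (part_in l) ml).
Qed.

Lemma boxes_draw_unopened : #|boxes_of (opened (S :\ m))| =
  #|boxes_of (opened S)| + #|boxes_of (pblock P m :\ m)|.
Proof.
have [_ sS] := unopenedP mS.
rewrite opened_draw_unopened /boxes_of bigcup_setU cardsU.
rewrite (_ : _ :&: _ = set0) ?cards0 ?subn0 //.
apply/setP=> x; rewrite !inE; apply/negP=> /andP[/bigcupP[l lS xl]].
case/bigcupP=> r /setD1P[_ rPm] xr; have [_ /negP[]] := openedP lS.
by rewrite (part_adj xl xr) (partE (part_in m) rPm).
Qed.

End DrawUnopened.

Local Open Scope ring_scope.

(** Compare with the same move in the absence of the opened lines. In the actual position the
    opponent has all opened boxes in addition, and at least the same loose ends and triples. *)
Lemma draw_unopened_le S m : m \in unopened S ->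
    - value (S :\ m) = score (S :\ m) ->
    - value (unopened S :\ m) = score (unopened S :\ m) ->
  - move_value S m <= - (#|boxes_of (opened S)|%:Z + value (unopened S)).
Proof.
move=> mS IHS IHE; have mE : m \in unopened (unopened S) by rewrite unopened_id.
have mE' := mE; rewrite unopened_id in mE'; have := value_le mE'.
rewrite /move_value /outcome (claimed_draw_unopened mS) (claimed_draw_unopened mE).
rewrite /= IHE opprK -[value (S :\ m)]opprK IHS /score.
rewrite (boxes_draw_unopened mS) (boxes_draw_unopened mE).
rewrite (unopened_draw_unopened mS) (unopened_draw_unopened mE).
rewrite (opened_draw_unopened mS) (opened_draw_unopened mE).
rewrite opened_unopened unopened_id set0U {1}/boxes_of big_set0 cards0 add0n.
have := @control_bonus_mono (loose_end (pblock P m :\ m)) (triple (pblock P m :\ m))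
  (loose_end (opened S :|: (pblock P m :\ m)))
  (triple (opened S :|: (pblock P m :\ m))) (value (unopened S :\: pblock P m)).
rewrite (introT implyP (@loose_endS _ _ (subsetUr _ _))).
rewrite (introT implyP (@tripleS _ _ (subsetUr _ _))) => /(_ isT isT).
lia.
Qed.

Theorem score_correct S : - value S = score S.
Proof.
have [n] := ubnP #|S|; elim: n S => // n IHn S leSn.
have IH A m : A \subset S -> m \in A -> - value (A :\ m) = score (A :\ m).
  move=> /subset_leq_card AS mA; apply: IHn; rewrite -ltnS.
  by apply: leq_trans leSn; rewrite ltnS (leq_trans _ AS) // (cardsD1 m A) mA.
case: (eqVneq (opened S) set0) => [oS0|oS_neq0].
  rewrite /score oS0 unopened_eq // /boxes_of big_set0 cards0 /control_bonus.
  case: ifP => [/loose_end_card|_]; first by rewrite cards0.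
  by case: ifP => [/triple_card|_]; rewrite ?cards0 ?add0r.
have sub_o : opened S \subset S by apply/subsetP=> l /openedP[].
have sub_u : unopened S \subset S by apply/subsetP=> l /unopenedP[].
have le_score m : m \in S -> - move_value S m <= score S.
  move=> mS; case mo: (m \in opened S).
    by apply: draw_opened_le => //; apply: IH.
  have mu : m \in unopened S by move: mo; rewrite !inE mS /= => /negbFE.
  have := draw_unopened_le mu (IH _ _ (subxx _) mS) (IH _ _ sub_u mu).
  have := control_bonus_ge (loose_end (opened S)) (triple (opened S))
    (value (unopened S)).
  by rewrite /score; clear; lia.
have ge_score m : m \in opened S -> score S <= - move_value S m ->
    score S <= - value S.
  move=> mo le_m; apply: le_trans le_m _; rewrite lerN2.
  by apply: value_le; apply: (subsetP sub_o).
apply/eqP; rewrite eq_le; apply/andP; split.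
  have [|m mS ->] := @value_attained _ S; last exact: le_score.
  by apply: contraNneq oS_neq0 => S0; rewrite -subset0 -S0.
have [c cS cl] := capturing_move oS_neq0.
have draw m (mS : m \in opened S) :=
  draw_opened mS (IH _ m (subxx _) (subsetP sub_o m mS)).
(* If the bonus is minus the untouched value, any capture will do: whatever pattern it destroys, the
   bonus cannot fall below that. *)
have take : control_bonus (loose_end (opened S)) (triple (opened S))
    (value (unopened S)) = - value (unopened S) -> score S <= - value S.
  move=> Db; apply: ge_score (cS) _.
  by rewrite draw // cl /score Db lerD2l control_bonus_ge.
(* Up to the thresholds 2 and 4, control does not repay its cost and [take] applies. Above them, a
   capture that preserves the pattern is played, or finally the gift of the last boxes. *)
case h : (loose_end (opened S)).
  have [le2|gt2] := lerP (value (unopened S)) 2.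
    by apply: take; rewrite /control_bonus h; lia.
  have [[m [mS clm hm]]|[m [mS clm le2 hm dm]]] := loose_end_move h;
    apply: ge_score (mS) _; rewrite draw // /score h ?clm ?hm //=.
  by rewrite (negbTE hm) (negbTE dm) /=; move: gt2 le2; clear; lia.
case d : (triple (opened S)); last by apply: take; rewrite h d.
have [le4|gt4] := lerP (value (unopened S)) 4.
  by apply: take; rewrite /control_bonus h d; lia.
have [[m [mS clm dm]]|[m [mS clm le4 hm dm]]] := triple_move (negbT h) d;
  apply: ge_score (mS) _; rewrite draw // /score h d ?clm ?dm /=.
  by rewrite lerD2l /control_bonus; case: ifP => _ //; move: gt4; clear; lia.
by rewrite (negbTE hm) (negbTE dm) /=; move: gt4 le4; clear; lia.
Qed.

(** Opening claims nothing and passes the turn, so the two sign changes cancel and [score] appears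
    directly. All boxes of [X] are still counted, since each keeps a line other than [m]. *)
Lemma open_part (Q : {set {set line G}}) X m :
    Q \subset P -> X \in Q -> m \in X ->
  move_value (cover Q) m = #|boxes_of X|%:Z +
    control_bonus (loose_end (X :\ m)) (triple (X :\ m)) (value (cover (Q :\ X))).
Proof.
move=> /subsetP sQP XQ mX; have Pm := partE (sQP X XQ) mX.
have memQ Y l : Y \in Q -> l \in Y -> (pblock P l = Y) * (l \in cover Q).
  by move=> YQ lY; split; [exact: partE (sQP Y YQ) lY | apply/bigcupP; exists Y].
have uE : unopened (cover Q) = cover Q.
  apply/setP=> l; rewrite inE andb_idr // => /bigcupP[Y YQ lY].
  by rewrite (memQ Y) //; apply: bigcup_sup YQ.
have mu : m \in unopened (cover Q) by rewrite uE (memQ X).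
have oE : opened (cover Q) = set0 by rewrite -uE opened_unopened.
rewrite /move_value /outcome (claimed_draw_unopened mu) /= score_correct /score.
rewrite (boxes_draw_unopened mu) (unopened_draw_unopened mu).
rewrite (opened_draw_unopened mu) oE set0U uE Pm {1}/boxes_of big_set0 cards0 add0n.
have -> : boxes_of (X :\ m) = boxes_of X.
  apply/setP=> x; apply/bigcupP/bigcupP=> -[l lX xl].
    by exists l => //; case/setD1P: lX.
  case: (eqVneq l m) => lm; last by exists l; rewrite // in_setD1 lm.
  have [r rl xr] := other_line xl; exists r => //.
  by rewrite in_setD1 -lm rl (adjacent_lines (sQP X XQ) lX xl xr).
congr (_ + control_bonus _ _ (value _)); apply/setP=> l; rewrite in_setD.
apply/andP/bigcupP=> [[nlX /bigcupP[Y YQ lY]]|[Y /setD1P[YX YQ] lY]].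
  by exists Y; rewrite // in_setD1 YQ andbT; apply: contraNneq nlX => <-.
split; last by rewrite (memQ Y).
by apply: contra YX => lX; rewrite -(memQ _ _ YQ lY).1 (memQ _ _ XQ lX).
Qed.

End PartiallyOpenedPositions.

(** * Loops and chains as connected components *)

Section Components.

Variable G : position.

Implicit Types (l m r s t : line G) (x y : box G) (X A : {set line G}).

(** The hypotheses on boxes and parts behind the exact score, localised to one set of lines. *)
Definition two_regular_component X : Prop :=
  [/\ forall l x, l \in X -> x \in border l -> #|[set r | x \in border r]| = 2,
      forall l r x, l \in X -> x \in border l -> x \in border r -> r \in X
    & forall A l, l \in X -> l \in A ->
        (forall s t x, s \in A -> x \in border s -> x \in border t -> t \in A) ->
        X \subset A].

Lemma ordS_neq n (i : 'I_n) : 1 < n -> ordS i != i.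
Proof.
move=> n1; rewrite -val_eqE /=; have := ltn_ord i; rewrite leq_eqVlt.
case/predU1P=> [Di|lt_in]; last by rewrite modn_small // gtn_eqF.
by rewrite Di modnn; apply: contraTneq n1 => i0; rewrite -Di -i0.
Qed.

Lemma iter_ordS n (i : 'I_n) k : iter k (@ordS n) i = (i + k) %% n :> nat.
Proof.
elim: k => [|k IHk] /=; first by rewrite addn0 modn_small.
by rewrite IHk -addn1 modnDml addn1 addnS.
Qed.

Lemma iter_ordS_eq n (i : 'I_n) j k : j < n -> k < n ->
  (iter j (@ordS n) i == iter k (@ordS n) i) = (j == k).
Proof.
by move=> jn kn; rewrite -val_eqE /= !iter_ordS eqn_modDl !modn_small.
Qed.

Section Loop.

Variables (n : nat) (X : {set line G}) (b : 'I_n -> box G) (e : 'I_n -> line G).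
Hypotheses (n4 : 4 <= n) (inj_b : injective b) (inj_e : injective e).
Hypothesis defX : X = [set e i | i : 'I_n].
Hypothesis border_e : forall i : 'I_n, border (e i) = [set b i; b (ordS i)].
Hypothesis closedX : forall l (j : 'I_n), b j \in border l -> l \in X.

Let eX i : e i \in X. Proof. by rewrite defX imset_f. Qed.

Let lines_b j : [set r | b j \in border r] = [set e j; e (ord_pred j)].
Proof.
apply/setP=> r; rewrite !inE; apply/idP/idP => [bjr|].
  have := closedX bjr; rewrite defX => /imsetP[i _ Dr].
  move: bjr; rewrite Dr border_e !inE !(inj_eq inj_b) !(inj_eq inj_e).
  by case/orP=> /eqP->; rewrite ?eqxx // ordSK eqxx orbT.
by case/orP=> /eqP->; rewrite border_e !inE ?ord_predK eqxx ?orbT.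
Qed.

Let box_of_X l x : l \in X -> x \in border l -> exists j, x = b j.
Proof.
by rewrite defX => /imsetP[i _ ->]; rewrite border_e => /set2P[]->; eexists.
Qed.

Lemma loop_two_regular : two_regular_component X.
Proof.
split=> [l x lX xl | l r x lX xl | A l lX lA clA].
- have [j ->] := box_of_X lX xl; rewrite lines_b cards2 (inj_eq inj_e).
  by rewrite -{1}(ord_predK j) ordS_neq // (leq_trans _ n4).
- by have [j ->] := box_of_X lX xl; apply: closedX.
move: lX lA; rewrite defX => /imsetP[i _ ->] eiA.
have iterA k : e (iter k (@ordS n) i) \in A.
  elim: k => //= k IHk; apply: (clA _ _ (b (ordS (iter k (@ordS n) i))) IHk).
    by rewrite border_e set22.
  by rewrite border_e set21.
apply/subsetP=> _ /imsetP[j _ ->].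
(* From [i], [n - i] steps lead to 0 and [j] more to [j]. *)
have -> : j = iter (n - i + j) (@ordS n) i.
  apply: val_inj; rewrite /= iter_ordS addnA subnKC; last exact: ltnW.
  by rewrite modnDl modn_small.
exact: iterA.
Qed.

Lemma loop_boxes : #|boxes_of X| = n.
Proof.
rewrite -[RHS](card_ord n) -(card_imset _ inj_b); congr #|pred_of_set _|.
apply/setP=> x; apply/bigcupP/imsetP=> [[l lX xl]|[j _ ->]].
  by have [j ->] := box_of_X lX xl; exists j.
by exists (e j); rewrite // border_e set21.
Qed.

Lemma loop_border l : l \in X -> #|border l| = 2.
Proof.
rewrite defX => /imsetP[i _ ->]; rewrite border_e cards2 (inj_eq inj_b).
by rewrite eq_sym ordS_neq // (leq_trans _ n4).
Qed.

Lemma loop_triple m : m \in X -> triple (X :\ m).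
Proof.
rewrite {1}defX => /imsetP[k _ ->]; pose f i := iter i (@ordS n) k.
have fE i j : i < 4 -> j < 4 -> (f i == f j) = (i == j).
  by move=> i4 j4; rewrite /f iter_ordS_eq // (leq_trans _ n4).
(* The three lines following [m] in cyclic order and the two boxes between them; [n >= 4] keeps
   these lines distinct from [m]. *)
apply/tripleP; exists (e (f 1)), (e (f 2)), (e (f 3)), (b (f 2)), (b (f 3)).
rewrite !in_setD1 !eX !andbT !(inj_eq inj_e) !(inj_eq inj_b).
by rewrite -[k]/(f 0) !fE // !border_e !inE !eqxx ?orbT.
Qed.

End Loop.

Section Chain.

Variables (n : nat) (X : {set line G}) (b : 'I_n -> box G).
Variable e : 'I_n.+1 -> line G.
Hypotheses (inj_b : injective b) (inj_e : injective e).
Hypothesis defX : X = [set e i | i : 'I_n.+1].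
Hypothesis border_e : forall i : 'I_n.+1,
  border (e i) = [set b j | j : 'I_n & (j.+1 == i) || (j == i :> nat)].
Hypothesis closedX : forall l (j : 'I_n), b j \in border l -> l \in X.

Let eX i : e i \in X. Proof. by rewrite defX imset_f. Qed.

Let pre (j : 'I_n) : 'I_n.+1 := widen_ord (leqnSn n) j.

Let post (j : 'I_n) : 'I_n.+1 := lift ord0 j.

Let border_b j i : (b j \in border (e i)) = (i == post j) || (i == pre j).
Proof.
rewrite border_e mem_imset // inE -!val_eqE /= /bump add1n.
by rewrite eq_sym (eq_sym (j : nat)).
Qed.

Let lines_b j : [set r | b j \in border r] = [set e (pre j); e (post j)].
Proof.
apply/setP=> r; rewrite !inE; apply/idP/idP => [bjr|].
  have := closedX bjr; rewrite defX => /imsetP[i _ Dr].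
  by move: bjr; rewrite Dr border_b !(inj_eq inj_e) orbC.
by case/orP=> /eqP->; rewrite border_b eqxx ?orbT.
Qed.

Let box_of_X l x : l \in X -> x \in border l -> exists j, x = b j.
Proof.
by rewrite defX => /imsetP[i _ ->]; rewrite border_e => /imsetP[j _ ->]; exists j.
Qed.

Lemma chain_two_regular : two_regular_component X.
Proof.
split=> [l x lX xl | l r x lX xl | A l lX lA clA].
- have [j ->] := box_of_X lX xl; rewrite lines_b cards2 (inj_eq inj_e).
  by rewrite -val_eqE /= /bump add1n ltn_eqF.
- by have [j ->] := box_of_X lX xl; apply: closedX.
have step j : (e (post j) \in A) = (e (pre j) \in A).
  by apply/idP/idP => jA; apply: (clA _ _ (b j) jA); rewrite border_b eqxx ?orbT.
have all0 k (i : 'I_n.+1) : i = k :> nat -> (e i \in A) = (e ord0 \in A).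
  elim: k i => [|k IHk] i Di; first by congr (e _ \in A); apply: val_inj.
  have kn : k < n by rewrite -ltnS -Di ltn_ord.
  have -> : i = post (Ordinal kn) by apply: val_inj; rewrite /= /bump add1n.
  by rewrite step; apply: IHk.
move: lX lA; rewrite defX => /imsetP[i _ ->]; rewrite (all0 i) // => e0A.
by apply/subsetP=> _ /imsetP[j _ ->]; rewrite (all0 j).
Qed.

Lemma chain_boxes : #|boxes_of X| = n.
Proof.
rewrite -[RHS](card_ord n) -(card_imset _ inj_b); congr #|pred_of_set _|.
apply/setP=> x; apply/bigcupP/imsetP=> [[l lX xl]|[j _ ->]].
  by have [j ->] := box_of_X lX xl; exists j.
by exists (e (pre j)); rewrite // border_b eqxx orbT.
Qed.

Let border_first (j : 'I_n) : j = 0 :> nat -> border (e (pre j)) = [set b j].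
Proof.
move=> j0; apply/setP=> x; apply/idP/set1P=> [xe|->]; last first.
  by rewrite border_b eqxx orbT.
have [k Dx] := box_of_X (eX _) xe; move: xe; rewrite Dx border_b -!val_eqE /= j0.
by move=> /eqP k0; congr b; apply: val_inj; rewrite /= j0.
Qed.

Let border_last (j : 'I_n) : j.+1 = n -> border (e (post j)) = [set b j].
Proof.
move=> jn; apply/setP=> x; apply/idP/set1P=> [xe|->]; last first.
  by rewrite border_b eqxx.
have [k Dx] := box_of_X (eX _) xe; move: xe; rewrite Dx border_b -!val_eqE /=.
rewrite /bump !add1n eqSS jn (gtn_eqF (ltn_ord k)) orbF => /eqP jk.
by congr b; apply: val_inj.
Qed.

Lemma chain_end : 0 < n -> exists2 l, l \in X & #|border l| = 1.
Proof.
by move=> n0; exists (e (pre (Ordinal n0))); rewrite // border_first // cards1.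
Qed.

Lemma chain_loose_end m : 3 <= n -> m \in X -> loose_end (X :\ m).
Proof.
move=> n3; rewrite {1}defX => /imsetP[k _ ->].
have prepost j : (pre j != post j) * (post j != pre j).
  by rewrite eq_sym -val_eqE /= /bump add1n gtn_eqF.
have n0 : 0 < n by apply: leq_trans n3.
have nn : n.-1 < n by rewrite prednK.
(* One end of the chain keeps its two outermost lines: the first end if [m] has index at least 2,
   and otherwise the last end, because [n - 1 > 1]. *)
apply/loose_endP; have [k2|k2] := leqP 2 k.
  pose j := Ordinal n0; exists (e (pre j)), (e (post j)), (b j).
  rewrite !in_setD1 !eX !andbT !(inj_eq inj_e) prepost border_b eqxx.
  by rewrite border_first // -!val_eqE /= ltn_eqF 1?ltn_eqF // (leq_trans _ k2).
pose j := Ordinal nn; exists (e (post j)), (e (pre j)), (b j).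
rewrite !in_setD1 !eX !andbT !(inj_eq inj_e) prepost border_b eqxx orbT.
have kn : k < n.-1 by rewrite (leq_trans k2) // -ltnS prednK.
rewrite border_last /= ?prednK // -!val_eqE /= /bump add1n prednK //.
by rewrite !gtn_eqF // (leq_trans kn) // leq_pred.
Qed.

End Chain.

End Components.

(** * Values of unions of loops and chains *)

Section Endgame.

Variables (G : position) (P : {set {set line G}}).

Implicit Types (X : {set line G}) (Q : {set {set line G}}) (m : line G).

Hypothesis partP : partition P [set: line G].
Hypothesis regularP : forall X, X \in P -> two_regular_component X.

(* In a simple loony endgame, only the end lines of a chain border one box. *)
Definition is_loop X : bool := [forall l in X, #|border l| == 2].

(** Sorting puts the shortest length first and makes the list depend only on the multiset of
    lengths. *)
Definition lengths (loop : bool) Q : seq nat :=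
  sort leq [seq #|boxes_of X| | X <- enum Q & is_loop X == loop].

Hypothesis loopP : forall X, X \in P -> is_loop X ->
  loop_length #|boxes_of X| /\ forall m, m \in X -> triple (X :\ m).
Hypothesis chainP : forall X, X \in P -> ~~ is_loop X ->
  3 < #|boxes_of X| /\ forall m, m \in X -> loose_end (X :\ m).

Let box_lines2 (x : box G) : #|[set l | x \in border l]| = 2.
Proof.
have /card_gt0P[l] : 0 < #|[set l | x \in border l]| by case/andP: (box_card x).
rewrite inE => xl; have : l \in cover P by rewrite (cover_partition partP) inE.
by case/bigcupP=> X /regularP[lines2 _ _] lX; apply: lines2 lX xl.
Qed.

Lemma open_component Q X m : Q \subset P -> X \in Q -> m \in X ->
  move_value (cover Q) m =
    (if is_loop X then open_loop else open_chain)
      #|boxes_of X| (value (cover (Q :\ X))).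
Proof.
move=> sQP XQ mX; have XP := subsetP sQP X XQ.
have adj Y l r x :
    Y \in P -> l \in Y -> x \in border l -> x \in border r -> r \in Y.
  by case/regularP=> _ adjY _; apply: adjY.
have conn Y (A : {set line G}) l : Y \in P -> l \in Y -> l \in A ->
    (forall s t x, s \in A -> x \in border s -> x \in border t -> t \in A) ->
    Y \subset A.
  by case/regularP=> _ _; apply.
rewrite (open_part partP box_lines2 adj conn sQP XQ mX) /control_bonus.
have [loopX|chainX] := boolP (is_loop X).
  rewrite ((loopP XP loopX).2 m mX) /open_loop.
  case: ifP => [/loose_endP[o [r [x [/setD1P[_ oX] _ _ Do _]]]]|_]; last first.
    by rewrite addrA addrAC.
  by have := forall_inP loopX o oX; rewrite Do cards1.
by rewrite ((chainP XP chainX).2 m mX) addrA addrAC.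
Qed.

(** Both sides are sorted and permutations of each other, hence equal. Removing a component thus
    becomes [rem], as in the arithmetic lemmas. *)
Lemma lengthsD1 loop Q X : X \in Q ->
  lengths loop (Q :\ X) =
    if is_loop X == loop then rem #|boxes_of X| (lengths loop Q)
    else lengths loop Q.
Proof.
move=> XQ; have perm_enum : perm_eq (enum Q) (X :: enum (Q :\ X)).
  apply: uniq_perm; rewrite /= ?enum_uniq ?mem_enum ?in_setD1 ?eqxx //.
  move=> Y; rewrite inE !mem_enum in_setD1.
  by case: eqVneq => // ->.
have : perm_eq (lengths loop Q)
    [seq #|boxes_of X| | X <- X :: enum (Q :\ X) & is_loop X == loop].
  by rewrite perm_sort; apply/perm_map/perm_filter.
rewrite /=; case: ifP => loopX /=.
  move=> perm_Q; have n_in : #|boxes_of X| \in lengths loop Q.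
    by rewrite (perm_mem perm_Q) mem_head.
  apply: (sorted_eq leq_trans anti_leq); first exact: (sort_sorted leq_total).
    apply: (subseq_sorted leq_trans (rem_subseq _ _)).
    exact: (sort_sorted leq_total).
  rewrite perm_sort -(perm_cons #|boxes_of X|) perm_sym.
  by rewrite -(permPl (perm_to_rem n_in)).
move=> perm_Q; apply: (sorted_eq leq_trans anti_leq).
- exact: (sort_sorted leq_total).
- exact: (sort_sorted leq_total).
by rewrite perm_sort perm_sym.
Qed.

Lemma mem_lengths loop Q X : X \in Q -> is_loop X = loop ->
  #|boxes_of X| \in lengths loop Q.
Proof.
by move=> XQ loopX; rewrite mem_sort map_f // mem_filter loopX eqxx mem_enum.
Qed.

Lemma lengthsP loop Q n : n \in lengths loop Q ->
  exists X, [/\ X \in Q, is_loop X = loop & n = #|boxes_of X|].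
Proof.
rewrite mem_sort => /mapP[X]; rewrite mem_filter mem_enum => /andP[/eqP]*.
by exists X.
Qed.

Lemma loop_lengths Q : Q \subset P -> all loop_length (lengths true Q).
Proof.
move=> /subsetP sQP; apply/allP=> n /lengthsP[X [XQ loopX ->]].
by case: (loopP (sQP X XQ) loopX).
Qed.

Lemma chain_lengths Q : Q \subset P -> all (leq 4) (lengths false Q).
Proof.
move=> /subsetP sQP; apply/allP=> n /lengthsP[X [XQ loopX ->]].
by case: (chainP (sQP X XQ) (negbT loopX)).
Qed.

(** [foldr] makes the head the first loop opened: loops in increasing order, then the chains, whose
    order does not affect the sum. *)
Definition endgame_value Q : int :=
  loops_value (chains_value (lengths false Q)) (lengths true Q).

(* The first length is the smallest, so this is the value of opening the
   shortest loop. *)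
Lemma endgame_value_loop Q n s : lengths true Q = n :: s ->
  exists X, [/\ X \in Q, is_loop X, n = #|boxes_of X|
    & endgame_value Q = open_loop n (endgame_value (Q :\ X))].
Proof.
move=> Dlen; have [|X [XQ loopX Dn]] := @lengthsP true Q n.
  by rewrite Dlen mem_head.
exists X; split=> //; rewrite /endgame_value !lengthsD1 // loopX /= Dlen -Dn.
by rewrite /= eqxx.
Qed.

(** For the last chain, [n - 2 + |0 - 2| = n]. Otherwise the rest has a value [v >= 4], and
    [n - 2 + |v - 2| = v + (n - 4)]. *)
Lemma endgame_value_chain Q n s : Q \subset P ->
    lengths true Q = [::] -> lengths false Q = n :: s ->
  exists X, [/\ X \in Q, ~~ is_loop X, n = #|boxes_of X|
    & endgame_value Q = open_chain n (endgame_value (Q :\ X))].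
Proof.
move=> sQP noloop Dlen.
have n_in : n \in lengths false Q by rewrite Dlen mem_head.
have [X [XQ chainX Dn]] := lengthsP n_in.
exists X; split=> //; first by rewrite chainX.
rewrite /endgame_value !lengthsD1 // chainX /= noloop /= -Dn.
have := allP (chain_lengths sQP) _ n_in.
have := chains_value_rem (chain_lengths sQP) n_in; rewrite /open_chain.
case=> [[-> ->] n4|[ge4 ->] n4]; last by lia.
by rewrite [chains_value [::]]/=; lia.
Qed.

(** Induction on the number of components. One opening, of a shortest loop or else of a chain,
    attains the formula; no opening does better, by [loops_value_rem_loop] and
    [loops_value_rem_chain]. *)
Theorem value_endgame Q : Q \subset P -> value (cover Q) = endgame_value Q.
Proof.
have [n] := ubnP #|Q|; elim: n Q => // n IHn Q leQn sQP.
have open_value X m : X \in Q -> m \in X -> move_value (cover Q) m =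
    (if is_loop X then open_loop else open_chain)
      #|boxes_of X| (endgame_value (Q :\ X)).
  move=> XQ mX; rewrite (open_component sQP XQ mX) IHn //.
    by move: leQn; rewrite (cardsD1 X) XQ ltnS.
  exact: subset_trans (subD1set _ _) sQP.
have line_of X : X \in Q -> exists m, m \in X.
  move=> /(subsetP sQP) XP; apply/set0Pn; apply: contraTneq XP => ->.
  by case/and3P: partP.
have le_opening X : X \in Q -> (value (cover Q) <=
    (if is_loop X then open_loop else open_chain)
      #|boxes_of X| (endgame_value (Q :\ X)))%R.
  move=> XQ; have [m mX] := line_of X XQ; rewrite -(open_value X m XQ mX).
  by apply: value_le; apply/bigcupP; exists X.
case: (eqVneq Q set0) => [-> | /set0Pn[X0 X0Q]].
  rewrite /cover big_set0 value_set0 /endgame_value /lengths.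
  by rewrite enum_set0.
have [m0 m0X] := line_of X0 X0Q.
apply/eqP; rewrite eq_le; apply/andP; split.
  case Dloops: (lengths true Q) => [|k s]; last first.
    have [X [XQ loopX Dk ->]] := endgame_value_loop Dloops.
    by have := le_opening X XQ; rewrite loopX Dk.
  case Dchains: (lengths false Q) => [|k s]; last first.
    have [X [XQ chainX Dk ->]] := endgame_value_chain sQP Dloops Dchains.
    by have := le_opening X XQ; rewrite (negbTE chainX) Dk.
  have := mem_lengths X0Q erefl; case: (is_loop X0).
    by rewrite Dloops.
  by rewrite Dchains.
have [|m mQ ->] := @value_attained G (cover Q).
  by apply/set0Pn; exists m0; apply/bigcupP; exists X0.
have [X XQ mX] := bigcupP mQ; rewrite (open_value X m XQ mX) /endgame_value.
rewrite !lengthsD1 //; case: ifP => loopX /=.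
  apply: loops_value_rem_loop; first exact: (sort_sorted leq_total).
    exact: loop_lengths.
  exact: mem_lengths.
apply: loops_value_rem_chain; first exact: (sort_sorted leq_total).
- exact: loop_lengths.
- exact: chain_lengths.
exact: mem_lengths.
Qed.

(** The formula opens the head of the sorted loop lengths first, so it suffices that this head is
    the length of [X]. *)
Theorem shortest_loop_optimal X m : X \in P -> is_loop X -> m \in X ->
    (forall Y, Y \in P -> is_loop Y -> #|boxes_of X| <= #|boxes_of Y|) ->
  optimal_move m.
Proof.
move=> XP loopX mX shortest; rewrite /optimal_move -(cover_partition partP).
rewrite (open_component (subxx P) XP mX) loopX.
rewrite !value_endgame ?subD1set //.
have n_in := mem_lengths XP loopX.
have : sorted leq (lengths true P) by apply: (sort_sorted leq_total).
case Dlen: (lengths true P) n_in => [//|h s] n_in /=.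
move=> /(order_path_min leq_trans)/allP h_min.
have Dh : h = #|boxes_of X|.
  apply/eqP; rewrite eqn_leq; apply/andP; split.
    by move: n_in; rewrite inE => /predU1P[->//|/h_min].
  have [|Y [YP loopY ->]] := @lengthsP true P h; first by rewrite Dlen mem_head.
  exact: shortest.
by rewrite /endgame_value !lengthsD1 // loopX /= Dlen -Dh /= eqxx.
Qed.

End Endgame.

(** * Transfer from the encoded loops and chains to the abstract endgame *)

Lemma loop_componentE (G : position) (n : nat) (X : {set line G}) :
    loop_component n X ->
  [/\ two_regular_component X, n = #|boxes_of X|, is_loop X, 3 < n
    & forall m, m \in X -> triple (X :\ m)].
Proof.
case=> n4 [b [e [[inj_b inj_e] defX border_e closedX]]]; split=> //.
- exact: loop_two_regular n4 inj_b inj_e defX border_e closedX.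
- by rewrite (loop_boxes inj_b defX border_e).
- by apply/forall_inP=> l lX; rewrite (loop_border n4 inj_b defX border_e).
exact: loop_triple n4 inj_b inj_e defX border_e.
Qed.

Lemma chain_componentE (G : position) (n : nat) (X : {set line G}) :
    3 <= n -> chain_component n X ->
  [/\ two_regular_component X, n = #|boxes_of X|, ~~ is_loop X
    & forall m, m \in X -> loose_end (X :\ m)].
Proof.
move=> n3 [b [e [[inj_b inj_e] defX border_e closedX]]]; split=> //.
- exact: chain_two_regular inj_b inj_e defX border_e closedX.
- by rewrite (chain_boxes inj_b defX border_e).
- have [|l lX l1] := chain_end inj_b defX border_e; first exact: leq_trans n3.
  by apply/forall_inPn; exists l => //; rewrite l1.
by move=> m; apply: chain_loose_end inj_b inj_e defX border_e _ n3.
Qed.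

(** A component given by itself is not known to belong to the chosen partition. It shares the line
    [m] with some part; both sets are connected and closed under sharing a box, so each contains the
    other. *)
Lemma two_regular_component_part (G : position) (P : {set {set line G}})
    (X : {set line G}) (m : line G) :
    partition P [set: line G] -> (forall Y, Y \in P -> two_regular_component Y) ->
    two_regular_component X -> m \in X -> X \in P.
Proof.
move=> partP regularP [_ adjX connX] mX.
have : m \in cover P by rewrite (cover_partition partP) inE.
case/bigcupP=> Y YP mY; have [_ adjY connY] := regularP Y YP.
suff -> : X = Y by [].
apply/eqP; rewrite eqEsubset; apply/andP; split.
  exact: connX mX mY adjY.
exact: connY mY mX adjX.
Qed.

Theorem theorem18 (G : position)
    (loonyG : simple_loony_endgame G)
    (has_loop : exists (n : nat) (X : {set line G}), loop_component n X)
    (no_3chain : forall X : {set line G}, ~ chain_component 3 X)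
    (n : nat) (L : {set line G})
    (loopL : loop_component n L)
    (shortestL : forall (k : nat) (X : {set line G}),
       loop_component k X -> n <= k)
    (m : line G) (Lm : m \in L) :
  optimal_move m.
Proof.
have [P partP loonyP] := loonyG.
have regularP X : X \in P -> two_regular_component X.
  case/loonyP=> [[k k3 /(chain_componentE k3)[]//]|[k _ /loop_componentE[]//]].
have [regularL Dn is_loopL _ _] := loop_componentE loopL.
have LP := two_regular_component_part partP regularP regularL Lm.
apply: (shortest_loop_optimal partP regularP _ _ LP is_loopL Lm).
- move=> X /loonyP[[k k3 /(chain_componentE k3)[_ _ /negbTE-> //]]|].
  by case=> k evenk /loop_componentE[_ <- _ k4 tri] _; split=> //; apply/andP.
- move=> X /loonyP[|[k _ /loop_componentE[_ _ ->]//]].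
  case=> k k3 chX; have [_ <- _ loose] := chain_componentE k3 chX.
  (* The absence of 3-chains raises the lower bound on chain lengths from 3 to 4. *)
  move=> _; split=> //; rewrite ltn_neqAle k3 andbT.
  by apply/eqP=> D3; case: (no_3chain X); rewrite D3.
move=> Y /loonyP[[k k3 /(chain_componentE k3)[_ _ /negbTE-> //]]|].
case=> k _ loopY _; rewrite -Dn.
by have [_ <- _ _ _] := loop_componentE loopY; apply: shortestL loopY.
Qed.
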